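(* For all nonzero integers $k,l$, the feasible region $F_{k,l}$ is convex, and contains the diagonal $D=\{(x,x):1\le x\le 2\}$.
   Context: For finite $A\subset\mathbb{Z}$ and an integer $k$, $A+k\cdot A=\{a_1+ka_2:a_1,a_2\in A\}$. For fixed integers $k,l$, the feasible region $F_{k,l}\subset\mathbb{R}^2$ is the closure of the set $$E_{k,l}=\left\{\left(\frac{\log|A+k\cdot A|}{\log|A|},\frac{\log|A+l\cdot A|}{\log|A|}\right)\right\}$$ as $A$ ranges over finite sets of integers (with $|A|\ge2$, so that the quotients are defined). *)

(* Defs.v *)
From HB Require Import structures.
From mathcomp Require Import all_boot all_order all_algebra finmap.
From mathcomp Require Import all_classical all_reals all_analysis.

Set Implicit Arguments.
Unset Strict Implicit.
Unset Printing Implicit Defensive.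

Import Order.TTheory GRing.Theory Num.Theory.
Import numFieldNormedType.Exports.

Local Open Scope fset_scope.
Local Open Scope classical_set_scope.
Local Open Scope ring_scope.

Definition sum_dilate (k : int) (A : {fset int}) : {fset int} :=
  [fset (a1 + k * a2)%R | a1 in A, a2 in A]%fset.

(* [R^o * R^o] is the plane with its scalar multiplication over [R], as required
   by [convex_set]; its topology is the product topology of [R * R]. The bound
   2 <= #|` A| makes the denominators nonzero (otherwise x / 0 = 0). *)
Definition feasible_points (R : realType) (k l : int) : set (R^o * R^o)%type :=
  [set (ln (#|` sum_dilate k A|%:R : R) / ln (#|` A|%:R : R),
        ln (#|` sum_dilate l A|%:R : R) / ln (#|` A|%:R : R))
   | A in [set A : {fset int} | (2 <= #|` A|)%N]].

Arguments feasible_points : clear implicits.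

Definition feasible_region (R : realType) (k l : int) : set (R^o * R^o)%type :=
  closure (feasible_points R k l).

Arguments feasible_region : clear implicits.

(* Main.v *)
Require Import Defs.
From HB Require Import structures.
From mathcomp Require Import all_boot all_order all_algebra finmap.
From mathcomp Require Import all_classical all_reals all_analysis.
From mathcomp Require Import zify ring lra.

(** Write F for the feasible region and E for the set of points whose closure
    it is.

    Convexity comes from a tensor trick. For a large integer N, depending on A,
    the set A + N . B behaves as the product A x B: its cardinality is |A||B|,
    and since (A + N . B) + k . (A + N . B) = (A + k . A) + N . (B + k . B),
    the cardinalities of its sums of dilates are multiplied too, simultaneously
    for k and for l ([realizedM]).
    Taking m copies of A and n copies of B
    gives a point of E that is the convex combination of the points of A and
    of B with weight m log|A| / (m log|A| + n log|B|) on the former. These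
    weights are dense in [0, 1] ([dense_weights]), so that the segment between
    two points of E lies in F ([feasible_points_segment]), and passing to the
    limit in the endpoints F is convex ([feasible_region_segment]).

    The diagonal is the segment from (1, 1) to (2, 2), so it is enough to put
    these two points in F. An interval of integers has |A + k . A| = O(|A|) and
    yields (1, 1). The set A of the first 2 n powers of 2 has |A + k . A|
    at least |A|^2 / 4 for all nonzero k, because i is recovered from 2^i + k 2^j with i < j modulo powers of 2; it
    yields (2, 2). *)

Set Implicit Arguments.
Unset Strict Implicit.

Import Order.TTheory GRing.Theory Num.Theory.
Import numFieldNormedType.Exports.

Local Open Scope classical_set_scope.
Local Open Scope ring_scope.

(** * Cardinalities of sums of dilates *)

Lemma card_imfset2_inj (T T' U : choiceType) (f : T -> T' -> U)
    (A : {fset T}) (B : {fset T'}) :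
  (forall a a' b b', a \in A -> a' \in A -> b \in B -> b' \in B ->
     f a b = f a' b' -> a = a' /\ b = b') ->
  #|` [fset f a b | a in A, b in B]%fset| = (#|` A| * #|` B|)%N.
Proof.
move=> f_inj; rewrite unlock /= size_seq_fset undup_id ?size_allpairs//.
rewrite allpairs_uniq_dep// ?fset_uniq//.
move=> [a b] [a' b'] /allpairsPdep[x [y [xA yB [-> ->]]]].
move=> /allpairsPdep[x' [y' [x'A y'B [-> ->]]]] /= e.
by have [-> ->] := f_inj _ _ _ _ xA x'A yB y'B e.
Qed.

Lemma leq_card_imfset2 (T T' U : choiceType) (f : T -> T' -> U)
    (A : {fset T}) (B : {fset T'}) :
  (#|` [fset f a b | a in A, b in B]%fset| <= #|` A| * #|` B|)%N.
Proof.
by rewrite unlock /= size_seq_fset (leq_trans (size_undup _)) ?size_allpairs.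
Qed.

Lemma sum_dilateP (k : int) (A : {fset int}) (x : int) :
  reflect (exists2 a1, a1 \in A & exists2 a2, a2 \in A & x = a1 + k * a2)
    (x \in sum_dilate k A).
Proof. exact: imfset2P. Qed.

(** A + k . A contains a translate A + k a of A. *)
Lemma leq_card_sum_dilate (k : int) (A : {fset int}) :
  (#|` A| <= #|` sum_dilate k A|)%N.
Proof.
have [->|[a aA]] := fset_0Vmem A; first by rewrite cardfs0.
pose B := [fset (x + k * a)%R | x in A]%fset.
have -> : #|` A| = #|` B|.
  by rewrite card_imfset//= => x y; apply: addIr.
apply: fsubset_leq_card; apply/fsubsetP => _ /imfsetP[x /= xA ->].
by apply/sum_dilateP; exists x => //; exists a.
Qed.

(** * Products of sets of integers *)

Definition add_dilate (N : int) (A B : {fset int}) : {fset int} :=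
  [fset (a + N * b)%R | a in A, b in B]%fset.

Lemma sum_dilate_add_dilate (k N : int) (A B : {fset int}) :
  sum_dilate k (add_dilate N A B) = add_dilate N (sum_dilate k A) (sum_dilate k B).
Proof.
apply/fsetP => x; apply/sum_dilateP/imfset2P.
  move=> [_ /imfset2P[/= a aA [b bB ->]]].
  move=> [_ /imfset2P[/= a' a'A [b' b'B ->]] ->].
  exists (a + k * a'); first by apply/sum_dilateP; exists a => //; exists a'.
  exists (b + k * b'); first by apply/sum_dilateP; exists b => //; exists b'.
  by ring.
move=> [_ /= /sum_dilateP[a aA [a' a'A ->]]].
move=> [_ /= /sum_dilateP[b bB [b' b'B ->]] ->].
exists (a + N * b); first by apply/imfset2P; exists a => //; exists b.
exists (a' + N * b'); first by apply/imfset2P; exists a' => //; exists b'.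
by ring.
Qed.

(** Once N exceeds every difference of two elements of A, the representation
    a + N b determines b, hence a. *)
Lemma card_add_dilate (A : {fset int}) : exists N0 : nat, forall N : nat,
  (N0 <= N)%N -> forall B, #|` add_dilate N A B| = (#|` A| * #|` B|)%N.
Proof.
pose S := (\sum_(a <- A) `|a|)%N.
have leS a : a \in A -> (`|a| <= S)%N.
  by move=> aA; rewrite /S (big_fsetD1 a)//= leq_addr.
(* S bounds the absolute values in A, so 2 S bounds the differences. *)
exists S.*2.+1 => N SN B; apply: card_imfset2_inj.
move=> a a' b b' /leS aS /leS a'S _ _ e.
have e' : a - a' = N%:Z * (b' - b) by rewrite mulrBr; lia.
have [bb|bb] := eqVneq (b' - b) 0.
  by split; [move: e'; rewrite bb mulr0; lia|lia].
have : (`|a - a'| = N * `|b' - b|)%N by rewrite e' abszM.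
have : (0 < `|b' - b|)%N by rewrite absz_gt0.
by nia.
Qed.

(** Only the three cardinalities of A matter for its point in the plane, and
    the triples that occur form a multiplicative monoid. *)
Definition realized (k l : int) (n p q : nat) :=
  exists A : {fset int},
    [/\ #|` A| = n, #|` sum_dilate k A| = p & #|` sum_dilate l A| = q].

Lemma realizedM (k l : int) (n p q n' p' q' : nat) :
  realized k l n p q -> realized k l n' p' q' ->
  realized k l (n * n') (p * p') (q * q').
Proof.
move=> [A [<- <- <-]] [B [<- <- <-]].
have [NA hA] := card_add_dilate A.
have [Nk hk] := card_add_dilate (sum_dilate k A).
have [Nl hl] := card_add_dilate (sum_dilate l A).
(* Any common upper bound of the three thresholds would do. *)
exists (add_dilate (NA + Nk + Nl)%N A B).
by rewrite !sum_dilate_add_dilate; split; [apply: hA|apply: hk|apply: hl]; lia.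
Qed.

Lemma realizedX (k l : int) (n p q m : nat) :
  realized k l n p q -> realized k l (n ^ m) (p ^ m) (q ^ m).
Proof.
move=> r; elim: m => [|m IH]; last by rewrite !expnS; exact: realizedM.
(* The triple (1, 1, 1) comes from {0}. *)
exists [fset 0]%fset; rewrite cardfs1 !expn0.
suff s j : sum_dilate j [fset 0]%fset = [fset 0]%fset by rewrite !s cardfs1.
apply/fsetP => x; rewrite inE; apply/sum_dilateP/eqP => [|->].
  by move=> [a /[!inE]/eqP-> [b /[!inE]/eqP->]] ->; rewrite mulr0.
by exists 0; rewrite ?inE//; exists 0; rewrite ?inE ?mulr0.
Qed.

(** * Sets with small and with large sums of dilates *)

(** With A = {0, ..., n - 1}, the set A + k . A lies in an interval of
    (2 |k| + 1) n integers starting at - |k| n, whatever the sign of k. *)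
Lemma interval_dilate (n : nat) : exists A : {fset int}, #|` A| = n /\
  forall k : int, (#|` sum_dilate k A| <= `|k|.*2.+1 * n)%N.
Proof.
exists [fset x in map Posz (iota 0 n)]%fset; split.
  by rewrite card_fseq undup_id ?size_map ?size_iota// map_inj_uniq ?iota_uniq// => x y [].
move=> k; pose S := [fset x in [seq (i%:Z - (`|k| * n)%N%:Z)%R |
  i <- iota 0 (`|k|.*2.+1 * n)]]%fset.
apply: (@leq_trans #|` S|); last first.
  by rewrite card_fseq (leq_trans (size_undup _))// size_map size_iota.
apply/fsubset_leq_card/fsubsetP => x /sum_dilateP[a aA [b bA ->]].
move: aA bA; rewrite !inE => /mapP[i + ->] /mapP[j + ->].
rewrite !mem_iota !add0n /= => iltn jltn.
apply/mapP; exists (absz (i%:Z + k * j%:Z + (`|k| * n)%N%:Z)).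
  rewrite mem_iota; nia.
nia.
Qed.

(** Since i < j, the largest power of 2 dividing 2^i + k 2^j is 2^i, so that the
    sum determines i. Concretely, if i were smaller than i', the equality would
    make 2^i divisible by 2^(i + 1). *)
Lemma geometric_inj (k : int) (i j i' j' : nat) : k != 0 ->
  (i < j)%N -> (i' < j')%N ->
  2 ^+ i + k * 2 ^+ j = 2 ^+ i' + k * 2 ^+ j' -> i = i' /\ j = j'.
Proof.
move=> k0; wlog ii : i j i' j' / (i <= i')%N.
  move=> H ij ij' e; have [|/ltnW] := leqP i i'; first by move=> /H; apply.
  by move=> /H /(_ ij' ij (esym e))[-> ->].
move=> ij ij' e; move: ii; rewrite leq_eqVlt => /orP[/eqP ii|ii].
  subst i'; split=> //; move/addrI : e => /(mulfI k0).
  exact: (@ieexprIn int 2).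
have : ((2 ^+ i.+1 : int) %| 2 ^+ i)%Z.
  have -> : 2 ^+ i = 2 ^+ i' + k * 2 ^+ j' - k * 2 ^+ j :> int.
    by rewrite -e addrK.
  by rewrite rpredB ?rpredD ?dvdz_mull ?dvdz_exp2l//; lia.
by rewrite dvdzE !abszX dvdn_Pexp2l// ltnn.
Qed.

(** A consists of the first 2 n powers of 2. Choosing i among the n smaller
    exponents and j among the n larger ones secures the condition i < j, and
    gives n^2 distinct elements 2^i + k 2^j of A + k . A. *)
Lemma geometric_dilate (n : nat) : exists A : {fset int}, #|` A| = n.*2 /\
  forall k : int, k != 0 -> (n * n <= #|` sum_dilate k A|)%N.
Proof.
exists [fset x in [seq (2 ^+ i : int)%R | i <- iota 0 n.*2]]%fset; split.
  rewrite card_fseq undup_id ?size_map ?size_iota//.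
  by rewrite map_inj_uniq ?iota_uniq//; exact: (@ieexprIn int 2).
move=> k k0.
pose I := [fset i in iota 0 n]%fset; pose J := [fset i in iota n n]%fset.
have cI : #|` I| = n by rewrite card_fseq undup_id ?iota_uniq// size_iota.
have cJ : #|` J| = n by rewrite card_fseq undup_id ?iota_uniq// size_iota.
have <- : #|` [fset (2 ^+ i + k * 2 ^+ j : int)%R | i in I, j in J]%fset| = (n * n)%N.
  rewrite card_imfset2_inj ?cI ?cJ// => i i' j j'.
  rewrite !inE !mem_iota => ? ? ? ?; apply: geometric_inj => //; lia.
apply/fsubset_leq_card/fsubsetP => _ /imfset2P[/= i + [j + ->]].
rewrite !inE !mem_iota => iI jJ.
apply/sum_dilateP; exists (2 ^+ i).
  by rewrite !inE map_f// mem_iota; lia.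
by exists (2 ^+ j) => //; rewrite !inE map_f// mem_iota; lia.
Qed.

(** * Convexity of the feasible region *)

Lemma closure_planeP (R : realType) (E : set (R^o * R^o)%type) (p : R^o * R^o) :
  closure E p <-> forall e : R, 0 < e ->
    exists q, [/\ E q, `|p.1 - q.1| <= e & `|p.2 - q.2| <= e].
Proof.
split=> [Ep e e0|H B /nbhs_ballP[e /= e0 eB]].
  have [q [Eq [/= q1 q2]]] := Ep _ (nbhsx_ballx p e e0).
  by exists q; split => //; exact: ltW.
have e20 : 0 < e / 2 by lra.
have [q [Eq q1 q2]] := H _ e20.
by exists q; split => //; apply: eB; split=> /=; rewrite -ball_normE /=; lra.
Qed.

(** The weights attached to m copies of a set of log-size a and n copies of one
    of log-size b are dense in [0, 1]: for a large real T, take for a m and b n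
    the multiples of a and b just below s T and (1 - s) T. The weight is then
    off by at most (a + b) / (T - a - b). *)
Lemma dense_weights (R : realType) (a b s e : R) :
  0 < a -> 0 < b -> 0 <= s <= 1 -> 0 < e ->
  exists m n : nat, 0 < a *+ m + b *+ n /\
    `|s - a *+ m / (a *+ m + b *+ n)| <= e.
Proof.
(* This T makes (a + b) / (T - a - b) equal to e. *)
move=> a0 b0 /andP[s0 s1] e0; pose T := (a + b) / e + (a + b).
have T0 : 0 <= T by rewrite addr_ge0 ?divr_ge0//; lra.
have s10 : 0 <= 1 - s by lra.
have m0 : 0 <= s * T / a by rewrite divr_ge0 ?mulr_ge0 ?(ltW a0).
have n0 : 0 <= (1 - s) * T / b by rewrite divr_ge0 ?mulr_ge0 ?(ltW b0).
have /andP[m1 m2] := truncn_itv m0; have /andP[n1 n2] := truncn_itv n0.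
set m := Num.truncn _ in m1 m2; set n := Num.truncn _ in n1 n2.
exists m, n; rewrite -[a *+ m]mulr_natl -[b *+ n]mulr_natl.
rewrite ler_pdivlMr// in m1; rewrite ltr_pdivrMr// -natr1 mulrDl mul1r in m2.
rewrite ler_pdivlMr// in n1; rewrite ltr_pdivrMr// -natr1 [ltRHS]mulrDl mul1r in n2.
set X := m%:R * a in m1 m2 *; set Y := n%:R * b in n1 n2 *.
have TE : T - (a + b) = (a + b) / e by rewrite /T; ring.
have XY : (a + b) / e < X + Y by lra.
have XY0 : 0 < X + Y by apply: le_lt_trans XY; rewrite divr_ge0//; lra.
split=> //; have -> : s - X / (X + Y) = (s * Y - (1 - s) * X) / (X + Y).
  by field; rewrite gt_eqF.
rewrite normrM normfV (gtr0_norm XY0) ler_pdivrMr//.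
rewrite ltr_pdivrMr// in XY; apply: (@le_trans _ _ (a + b)); last by lra.
have sY := ler_wpM2l s0 n1.
have sY' : s * ((1 - s) * T) - s * b <= s * Y by rewrite -mulrBr ler_wpM2l//; lra.
have sX := ler_wpM2l s10 m1.
have sX' : (1 - s) * (s * T) - (1 - s) * a <= (1 - s) * X.
  by rewrite -mulrBr ler_wpM2l//; lra.
have sb := ler_wpM2r (ltW b0) s1.
have sa : (1 - s) * a <= a by rewrite ler_piMl//; lra.
rewrite ler_norml; apply/andP; split; nra.
Qed.

Lemma feasible_pointsP (R : realType) (k l : int) (x : R^o * R^o) :
  feasible_points R k l x <-> exists n p q : nat,
    [/\ realized k l n p q, (2 <= n)%N &
        x = (ln p%:R / ln n%:R, ln q%:R / ln n%:R)].
Proof.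
split=> [[A /= A2 <-]|[n [p [q [[A [<- <- <-]] A2 ->]]]]]; last by exists A.
by exists #|` A|, #|` sum_dilate k A|, #|` sum_dilate l A|; split=> //; exists A.
Qed.

Lemma realized_le (k l : int) (n p q : nat) :
  realized k l n p q -> (n <= p)%N /\ (n <= q)%N.
Proof. by move=> [A [<- <- <-]]; split; apply: leq_card_sum_dilate. Qed.

Lemma ln_natXM (R : realType) (p q m n : nat) : (0 < p)%N -> (0 < q)%N ->
  ln (p ^ m * q ^ n)%:R = ln p%:R *+ m + ln q%:R *+ n :> R.
Proof.
move=> p0 q0; rewrite natrM lnM ?posrE ?ltr0n ?expn_gt0 ?p0 ?q0//.
by rewrite !natrX !lnXn ?ltr0n.
Qed.

(** The point of the product of m copies of A and n copies of B is the
    combination s u + (1 - s) v with s = m log|A| / (m log|A| + n log|B|), so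
    t u + (1 - t) v differs from it by (t - s) (u - v). *)
Lemma feasible_points_segment (R : realType) (k l : int) (u v : R^o * R^o)
    (t e : R) :
  feasible_points R k l u -> feasible_points R k l v -> 0 <= t <= 1 -> 0 < e ->
  exists2 w, feasible_points R k l w &
    `|t * u.1 + (1 - t) * v.1 - w.1| <= e /\
    `|t * u.2 + (1 - t) * v.2 - w.2| <= e.
Proof.
move=> /feasible_pointsP[a [p [q [ra a2 ->]]]].
move=> /feasible_pointsP[b [p' [q' [rb b2 ->]]]] t01 e0 /=.
have [ap aq] := realized_le ra; have [bp bq] := realized_le rb.
have la0 : 0 < ln a%:R :> R by rewrite ln_gt0// ltr1n.
have lb0 : 0 < ln b%:R :> R by rewrite ln_gt0// ltr1n.
set x1 := ln p%:R / ln a%:R; set x2 := ln q%:R / ln a%:R.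
set y1 := ln p'%:R / ln b%:R; set y2 := ln q'%:R / ln b%:R.
(* D bounds both coordinates of u - v; the summand 1 makes it positive. *)
pose D := 1 + `|x1 - y1| + `|x2 - y2|.
have D0 : 0 < D by rewrite /D !ltr_wpDr.
have [m [n [mn0 wt]]] := dense_weights la0 lb0 t01 (divr_gt0 e0 D0).
set N := _ + _ in mn0 wt.
have lnN : ln (a ^ m * b ^ n)%:R = N by rewrite ln_natXM//; lia.
have ratio r r' : (0 < r)%N -> (0 < r')%N ->
    `|ln r%:R / ln a%:R - ln r'%:R / ln b%:R| <= D ->
    `|t * (ln r%:R / ln a%:R) + (1 - t) * (ln r'%:R / ln b%:R)
      - ln (r ^ m * r' ^ n)%:R / N| <= e.
  move=> r0 r'0 rD; rewrite ln_natXM//.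
  have -> : t * (ln r%:R / ln a%:R) + (1 - t) * (ln r'%:R / ln b%:R)
      - (ln r%:R *+ m + ln r'%:R *+ n) / N =
      (t - ln a%:R *+ m / N) * (ln r%:R / ln a%:R - ln r'%:R / ln b%:R) :> R.
    have NE : N = m%:R * ln a%:R + n%:R * ln b%:R by rewrite /N !mulr_natl.
    move: mn0; rewrite NE => mn0.
    rewrite -[ln r%:R *+ m]mulr_natl -[ln r'%:R *+ n]mulr_natl.
    rewrite -[ln a%:R *+ m]mulr_natl.
    by field; rewrite !gt_eqF.
  rewrite normrM; apply: (@le_trans _ _ (e / D * D)); first exact: ler_pM.
  by rewrite divfK ?gt_eqF.
exists (ln (p ^ m * p' ^ n)%:R / N, ln (q ^ m * q' ^ n)%:R / N); last first.
  split; apply: ratio; rewrite -/x1 -/x2 -/y1 -/y2 /D; try lia.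
    by rewrite -addrA addrCA lerDl addr_ge0.
  by rewrite lerDr addr_ge0.
apply/feasible_pointsP; exists (a ^ m * b ^ n)%N, (p ^ m * p' ^ n)%N, (q ^ m * q' ^ n)%N.
split; [by apply: realizedM; apply: realizedX| |by rewrite lnN].
(* The product has at least two elements because the logarithm of its size
   is positive. *)
rewrite ltnNge; apply/negP => ab1.
by move: mn0; rewrite -lnN ltNge ln_le0// lern1.
Qed.

(** The endpoints are approximated within e / 2 by points of E, and the
    combination of these by another point of E, again within e / 2. *)
Lemma feasible_region_segment (R : realType) (k l : int) (u v : R^o * R^o)
    (t : R) :
  feasible_region R k l u -> feasible_region R k l v -> 0 <= t <= 1 ->
  feasible_region R k l (t *: u + (1 - t) *: v).
Proof.
move=> /closure_planeP uF /closure_planeP vF t01.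
apply/closure_planeP => e e0; have e20 : 0 < e / 2 by lra.
have [u' [u'E u1 u2]] := uF _ e20; have [v' [v'E v1 v2]] := vF _ e20.
have [w wE [w1 w2]] := feasible_points_segment u'E v'E t01 e20.
have /andP[t0 t1] := t01; have s0 : 0 <= 1 - t by lra.
have tri (x y x' y' z : R) : `|x - x'| <= e / 2 -> `|y - y'| <= e / 2 ->
    `|t * x' + (1 - t) * y' - z| <= e / 2 ->
    `|t * x + (1 - t) * y - z| <= e.
  rewrite !ler_norml => /andP[xl xr] /andP[yl yr] /andP[zl zr].
  have := ler_wpM2l t0 xl; have := ler_wpM2l t0 xr.
  have := ler_wpM2l s0 yl; have := ler_wpM2l s0 yr.
  by move=> *; apply/andP; split; lra.
exists w; split=> //; rewrite /= /GRing.scale /=.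
  exact: tri u1 v1 w1.
exact: tri u2 v2 w2.
Qed.

(** * The two ends of the diagonal *)

(** If |A| = 2^M and |A + j . A| is 2^(d M) up to a factor 2^c that does not
    depend on M, the ratios of logarithms are within c / M of d. *)
Lemma feasible_region_corner (R : realType) (k l : int) (d c : nat) :
  (forall m, exists A : {fset int}, #|` A| = (2 ^ m.+1)%N /\
     forall j, j \in [:: k; l] ->
       (2 ^ (d * m.+1) <= #|` sum_dilate j A| * 2 ^ c)%N /\
       (#|` sum_dilate j A| <= 2 ^ (d * m.+1 + c))%N) ->
  feasible_region R k l (d%:R, d%:R).
Proof.
move=> HA; apply/closure_planeP => e e0.
(* m is chosen so that c / (m + 1) < e. *)
have /truncn_itv/andP[_] : 0 <= c%:R / e by rewrite divr_ge0// ltW.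
set m := Num.truncn _; rewrite ltr_pdivrMr// => cm.
have [A [cA hA]] := HA m.
have l20 : 0 < ln 2 :> R by rewrite ln_gt0// ltr1n.
have lnX i : ln (2 ^ i)%:R = i%:R * ln 2 :> R.
  by rewrite natrX lnXn// mulr_natl.
have near j : j \in [:: k; l] ->
    `|d%:R - ln #|` sum_dilate j A|%:R / ln #|` A|%:R| <= e :> R.
  move=> /hA[lo hi]; set q := #|` _| in lo hi *.
  have q0 : (0 < q)%N.
    by case: q lo {hi} => //; rewrite mul0n leqNgt expn_gt0.
  have le_ln (x y : nat) : (0 < x)%N -> (x <= y)%N -> ln x%:R <= ln y%:R :> R.
    by move=> x0 xy; rewrite ler_ln ?posrE ?ltr0n ?ler_nat// (leq_trans x0).
  have := le_ln _ _ q0 hi; rewrite lnX natrD natrM => {}hi.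
  have := le_ln _ _ _ lo; rewrite expn_gt0 => /(_ isT).
  rewrite natrM lnM ?posrE ?ltr0n ?expn_gt0// !lnX natrM => {}lo.
  rewrite cA lnX; have M0 : 0 < m.+1%:R * ln 2 :> R by rewrite mulr_gt0.
  have -> : d%:R - ln q%:R / (m.+1%:R * ln 2) =
     (d%:R * m.+1%:R * ln 2 - ln q%:R) / (m.+1%:R * ln 2) :> R.
    by field; rewrite !gt_eqF.
  rewrite normrM normfV (gtr0_norm M0) ler_pdivrMr//.
  rewrite -(ltr_pM2r l20) in cm.
  by rewrite ler_norml; apply/andP; split; lra.
exists (ln #|` sum_dilate k A|%:R / ln #|` A|%:R,
        ln #|` sum_dilate l A|%:R / ln #|` A|%:R).
split; last 2 first.
- by apply: near; rewrite inE eqxx.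
- by apply: near; rewrite !inE eqxx orbT.
by exists A => //=; rewrite cA -{1}(expn1 2) leq_exp2l.
Qed.

Lemma feasible_region_11 (R : realType) (k l : int) :
  feasible_region R k l (1, 1).
Proof.
apply: (@feasible_region_corner R k l 1 (`|k| + `|l|).*2) => m.
have [A [cA hA]] := interval_dilate (2 ^ m.+1); exists A; split=> // j jkl.
rewrite mul1n -cA; split.
  by rewrite -[leqLHS]muln1 leq_mul ?leq_card_sum_dilate ?expn_gt0.
rewrite expnD -cA mulnC (leq_trans (hA j))// -cA leq_mul2r; apply/orP; right.
apply: (@leq_trans (2 ^ `|j|.*2)); first by rewrite ltn_expl.
by rewrite leq_exp2l// leq_double; move: jkl; rewrite !inE => /orP[]/eqP->; lia.
Qed.

Lemma feasible_region_22 (R : realType) (k l : int) : k != 0 -> l != 0 ->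
  feasible_region R k l (2, 2).
Proof.
move=> k0 l0; apply: (@feasible_region_corner R k l 2 2) => m.
have [A [cA hA]] := geometric_dilate (2 ^ m); exists A.
have {}cA : #|` A| = (2 ^ m.+1)%N by rewrite cA expnS mul2n.
split=> // j jkl.
have j0 : j != 0 by move: jkl; rewrite !inE => /orP[]/eqP->.
split.
  rewrite mul2n -addnn expnD.
  apply: (@leq_trans (2 ^ m * 2 ^ m * 2 ^ 2)); last by rewrite leq_mul2r hA.
  by rewrite !expnS expn0; lia.
apply: leq_trans (leq_card_imfset2 _ _ _) _.
by rewrite cA -expnD leq_exp2l// mul2n -addnn leq_addr.
Qed.

Unset Implicit Arguments.
Set Strict Implicit.

Theorem theorem8 (R : realType) (k l : int) (hk : k != 0) (hl : l != 0) :
  convex_set (feasible_region R k l) /\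
  [set (x, x) | x in [set x : R^o | 1 <= x <= 2]] `<=` feasible_region R k l.
Proof.
split=> [u v t|_ [x /= /andP[x1 x2] <-]].
  rewrite !inE => uF vF; apply: feasible_region_segment => //.
  by apply/andP; split.
have x01 : 0 <= 2 - x <= 1 by apply/andP; split; lra.
have xE : (x : R) = (2 - x) * 1 + (1 - (2 - x)) * 2 by ring.
have -> : (x, x) = (2 - x) *: ((1, 1) : R^o * R^o)
    + (1 - (2 - x)) *: ((2, 2) : R^o * R^o).
  by congr pair; exact: xE.
apply: feasible_region_segment x01; first exact: feasible_region_11.
exact: feasible_region_22.
Qed.
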